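(* Let $f:\mathbb{R}\times[0,1]\to\mathbb{R}$ be measurable, let $\mu_0\in\mathbb{R}$ be fixed, let $(\xi_t)_{t\ge 0}$ be independent random variables each uniformly distributed on $[0,1]$, and define $\mu_{t+1}=\mu_t+f(\mu_t,\xi_t)$ for $t\ge 0$. Let $F(\mu,x)=\mathbb{P}_{\xi\sim U([0,1])}(f(\mu,\xi)\le x)$ and $\bar f(\mu)=\mathbb{E}_{\xi\sim U([0,1])}[f(\mu,\xi)]$. Assume that $F$ is continuous at $(\mu,0)$ for every $\mu\in\mathbb{R}$, and that there exists $\mu_\circ\in\mathbb{R}$ such that $F(\mu,0)<1$ for all $\mu\ge\mu_\circ$ and $F(\mu,0)>0$ for all $\mu\le\mu_\circ$. Assume additionally that there exists $c\in\mathbb{R}$ such that $|\mu_{t+1}-\mu_t|\le c$ almost surely for all $t$, and that there exists $\epsilon>0$ such that $\bar f(\mu)>\epsilon$ for all sufficiently large $\mu$ and $\bar f(\mu)<-\epsilon$ for all sufficiently small (i.e. sufficiently negative) $\mu$. Then almost surely either $\lim_{t\to\infty}\mu_t=\infty$ or $\lim_{t\to\infty}\mu_t=-\infty$.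
   Context: $U([0,1])$ denotes the uniform distribution on $[0,1]$. The sequence $(\mu_t)$ models a user's interest in a fixed item over time; the conclusion is called strong degeneracy. *)

(* Defs.v *)
From HB Require Import structures.
From mathcomp Require Import all_boot all_order all_algebra.
From mathcomp Require Import all_classical all_reals all_analysis.
Set Implicit Arguments. Unset Strict Implicit. Unset Printing Implicit Defensive.
Import Order.TTheory GRing.Theory Num.Theory.
Import numFieldNormedType.Exports.
Local Open Scope classical_set_scope.
Local Open Scope ring_scope.

Definition U01 (R : realType) := uniform_prob (@ltr01 R).
Arguments U01 R : clear implicits.

Definition mutually_independent {d} {Omega : measurableType d} {R : realType}
  (P : probability Omega R) (X : nat -> Omega -> R) : Prop :=
  forall (s : seq nat) (B : nat -> set R), uniq s ->
    (forall i, measurable (B i)) ->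
    P (\bigcap_(i in [set` s]) (X i @^-1` B i)) =
    (\prod_(i <- s) P (X i @^-1` B i))%E.

Fixpoint traj {Omega : Type} {R : realType} (f : R -> R -> R) (mu0 : R)
  (xi : nat -> Omega -> R) (t : nat) (w : Omega) : R :=
  match t with
  | O => mu0
  | S t' => traj f mu0 xi t' w + f (traj f mu0 xi t' w) (xi t' w)
  end.

Definition Fdist {R : realType} (f : R -> R -> R) (m x : R) : R :=
  fine (U01 R [set y | f m y <= x]).

Definition fbar {R : realType} (f : R -> R -> R) (m : R) : \bar R :=
  (\int[U01 R]_y (f m y)%:E)%E.

(* Main.v *)
Require Import Defs.
From HB Require Import structures.
From mathcomp Require Import all_boot all_order all_algebra.
From mathcomp Require Import all_classical all_reals all_analysis.
From mathcomp Require Import measurable_realfun lra.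
Import Order.TTheory GRing.Theory Num.Theory.
Import numFieldNormedType.Exports.
Import HBNNSimple.
Local Open Scope classical_set_scope.
Local Open Scope ring_scope.

(* Let [r m = |m - a|], where [a] is the point separating the two conditions on
   [F].  The bounded function
     W m = max (min (e^(A r)) (e^(A L))) (C (1 - e^(-l (r - K))))
   satisfies the drift inequality E[W(m + f(m, xi))] >= W m + k e^(-l r) for
   every [m] whose step is bounded by [c].  For small [r] this holds because a
   step goes outwards by at least [e] with probability at least [e], uniformly
   on compact sets by continuity of [F] at (m, 0), and [A] is so large that this
   event alone doubles e^(A r); for large [r] it is the usual exponential
   estimate for a bounded step with mean drift eps.  As each of the two functions
   dominates where the estimate for the other one fails, the maximum inherits
   both estimates.  Summing over time, sum_t E[k e^(-l |mu_t - a|)] is at most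
   sup W, so |mu_t - a| tends to infinity almost surely, and bounded steps cannot
   change sides infinitely often. *)

(** * Deterministic estimates and compactness *)

(** Inverting [1 - u <= expR (- u)] bounds [expR u] by [1 / (1 - u)], and [(1 - u) * (1 + u + 2 * u
    ^+ 2) = 1 + u ^+ 2 * (1 - 2 * u)] is at least 1 when [u <= 2^-1]. *)
Lemma expR_le_quadratic (R : realType) (u : R) :
  u <= 2^-1 -> expR u <= 1 + u + 2 * u ^+ 2.
Proof.
move=> u2; have := expR_ge1Dx (- u); rewrite expRN => h.
have v0 : 0 < 1 - u by lra.
have e0 := expR_gt0 u.
have := ler_wpM2l (ltW e0) h; rewrite mulfV ?gt_eqF// => h1.
nra.
Qed.

(** Once the distance to [a] stays at least [c + 1], a step of length at most [c] cannot cross [a],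
    so the side of [a] is frozen from then on. *)
Lemma cvg_pm_infty_bounded_steps (R : realType) (u : nat -> R) (a c : R) :
  (forall t, `|u t.+1 - u t| <= c) ->
  (fun t => `|u t - a|) @ \oo --> +oo ->
  u @ \oo --> +oo \/ u @ \oo --> -oo.
Proof.
move=> uc /cvgryPge ua.
have c0 : 0 <= c by apply: le_trans (uc 0%N); exact: normr_ge0.
have [N _ hN] := ua (c + 1).
have {}hN n : (N <= n)%N -> c + 1 <= `|u n - a| by move=> Nn; exact: hN.
have step n : (N <= n)%N -> (a < u n) = (a < u n.+1).
  move=> Nn; have := hN _ Nn; have := hN _ (leqW Nn); have := uc n.
  rewrite ler_norml => /andP[h1 h2].
  case: (ger0P (u n - a)) => h3; case: (ger0P (u n.+1 - a)) => h4 h5 h6;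
    by apply/idP/idP => h7; lra.
have sgn k : (a < u (N + k)%N) = (a < u N).
  elim: k => [|k <-]; first by rewrite addn0.
  by rewrite addnS -step// leq_addr.
have [auN|auN] := boolP (a < u N);
  [left; apply/cvgryPge => A|right; apply/cvgrNyPle => A].
  have [M _ hM] := ua (`|A| + `|a|).
  exists (maxn N M) => // n /=; rewrite geq_max => /andP[Nn Mn].
  have := hM n Mn; have := sgn (n - N)%N; rewrite subnKC// auN => sn.
  have h : a < u n by rewrite sn.
  have := ler_norm A; have := ler_norm (- a); rewrite normrN => h1 h2.
  rewrite /= [`|u n - a|]gtr0_norm; [move=> h3|]; lra.
have [M _ hM] := ua (`|A| + `|a|).
exists (maxn N M) => // n /=; rewrite geq_max => /andP[Nn Mn].
have := hM n Mn; have := sgn (n - N)%N; rewrite subnKC// (negbTE auN) => /negbT h.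
have := ler_norm (- A); have := ler_norm (a); rewrite normrN => h1 h2.
rewrite -leNgt in h; rewrite /= [`|u n - a|]ler0_norm; [move=> h3|]; lra.
Qed.

(** Continuity settles each point of the segment together with its neighbours, and compactness
    merges the local thresholds on [e] into one. The factor [s] lets [G] be probed at [e] or at
    [- e]. *)
Lemma near_uniform_segment (R : realType) (G : R * R -> R) (s a b k : R) :
  (forall m, a <= m <= b -> {for (m, 0), continuous G} /\ G (m, 0) < k) ->
  \forall e \near 0^'+, forall m, a <= m <= b -> G (m, s * e) < k - e.
Proof.
move=> Gk.
have : \forall e \near 0^'+, `[a, b] `<=` (fun m => G (m, s * e) < k - e).
  move: (@segment_compact R a b) => /compact_near_coveringP; apply.
  move=> m; rewrite /= in_itv/= => /Gk[Gc Gm].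
  pose e0 := (k - G (m, 0)) / 2.
  have e0gt0 : 0 < e0 by rewrite /e0; lra.
  have : \forall p \near (m, 0 : R), G p < k - e0.
    apply: (Gc [set x | x < k - e0]); apply: open_nbhs_nbhs; split; first exact: open_lt.
    by rewrite /e0 /=; lra.
  case=> -[/= U V] [Um V0] UV.
  exists (U, [set e | V (s * e) /\ e < e0]) => /=.
    split => //; apply: filterI; last exact: nbhs_right_lt.
    suff : (fun e => s * e) @ 0^'+ --> (0 : R) by exact.
    rewrite -[X in _ --> X](mulr0 s); apply: cvgMl_tmp; exact: cvg_at_right_filter.
  case=> m' e /= [Um' [Ve ee0]].
  by apply: lt_trans (UV (m', s * e) _) _ => //; lra.
by apply: filterS => e h m mab; apply: h; rewrite /= in_itv.
Qed.

(** * The Lyapunov function and its drift *)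

(** The cap at distance [L] keeps the inner branch bounded. For positive [l] and [C] the outer
    branch vanishes at distance [K] and increases to [C]. *)
Definition lyap {R : realType} (a A L C l K m : R) : R :=
  Num.max (Num.min (expR (A * `|m - a|)) (expR (A * L)))
          (C * (1 - expR (- l * (`|m - a| - K)))).

Section lyapunov.
Context {R : realType} (a A L C l K : R).
Hypotheses (A0 : 0 <= A) (C0 : 0 <= C).
Let W := lyap a A L C l K.

Lemma lyap_ge0 m : 0 <= W m.
Proof. by rewrite /W /lyap le_max le_min !expR_ge0. Qed.

Lemma lyap_le m : W m <= Num.max (expR (A * L)) C.
Proof.
rewrite /W /lyap ge_max !le_max !ge_min lexx orbT/=.
by apply/orP; right; rewrite ler_piMr// gerBl expR_ge0.
Qed.

Lemma measurable_lyap : measurable_fun setT W.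
Proof.
have mr : measurable_fun setT (fun m : R => `|m - a|).
  by apply: measurableT_comp => //; exact: measurable_funB.
apply: measurable_maxr.
  apply: measurable_minr => //; apply: measurableT_comp => //.
  exact: measurable_funM.
apply: measurable_funM => //; apply: measurable_funB => //.
apply: measurableT_comp => //; apply: measurable_funM => //.
exact: measurable_funB.
Qed.

Context (Q : probability R R) (h : R -> R) (m : R).
Hypothesis mh : measurable_fun setT h.

Let mWh : measurable_fun setT (fun y => (W (m + h y))%:E).
Proof.
apply/measurable_EFinP; apply: (measurableT_comp measurable_lyap).
exact: measurable_funD.
Qed.

(** Only the event [S] is counted, the rest contributing at least 0. On [S] the exponential, not yet
    capped at distance [|m - a| + e], gains the factor [expR (A * e)], which outweighs the
    probability [e] by a factor 2. *)
Lemma lyap_drift_inner (S : set R) (e : R) :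
  measurable S -> (e%:E <= Q S)%E -> `|m - a| + e <= L -> 2 <= expR (A * e) * e ->
  (forall y, S y -> `|m - a| + e <= `|m + h y - a|) ->
  ((2 * expR (A * `|m - a|))%:E <= \int[Q]_y (W (m + h y))%:E)%E.
Proof.
move=> mS eS mL Ae Sh.
apply: (@le_trans _ _ (\int[Q]_(y in S) (expR (A * (`|m - a| + e)))%:E)%E).
  rewrite integral_cst//=.
  apply: (@le_trans _ _ ((expR (A * (`|m - a| + e)))%:E * e%:E)%E).
    by rewrite -EFinM lee_fin mulrDr expRD -mulrA [2 * _]mulrC ler_wpM2l// expR_ge0.
  by rewrite lee_wpmul2l// lee_fin expR_ge0.
apply: (@le_trans _ _ (\int[Q]_(y in S) (W (m + h y))%:E)%E).
  apply: ge0_le_integral => //=.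
  - exact: measurable_funTS.
  - move=> y /Sh hy; rewrite lee_fin /W /lyap le_max le_min !ler_expR.
    by rewrite !ler_wpM2l.
apply: ge0_subset_integral => //= y _.
by rewrite lee_fin lyap_ge0.
Qed.

(** Here [s] acts as the sign of [m - a], so the new distance is at least [|m - a| + s * h y].
    Expanding the exponential to second order, the mean drift gains a relative [l * eps], and the
    quadratic term costs [2 * l ^+ 2 * c ^+ 2], at most half of it. *)
Lemma lyap_drift_outer (s c eps : R) :
  (forall y, `|h y| <= c) -> `|s| <= 1 -> s * (m - a) = `|m - a| ->
  0 < l -> l * c <= 2^-1 -> 4 * l * c ^+ 2 <= eps ->
  (eps%:E < \int[Q]_y (s * h y)%:E)%E ->
  ((C * (1 - expR (- l * (`|m - a| - K)))
    + C * expR (- l * (`|m - a| - K)) * l * eps / 2)%:E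
     <= \int[Q]_y (W (m + h y))%:E)%E.
Proof.
move=> hc s1 sr l0 lc l4 seps.
have c0 : 0 <= c by apply: le_trans (hc 0); exact: normr_ge0.
pose E := expR (- l * (`|m - a| - K)).
have E0 : 0 <= E by exact: expR_ge0.
have shc y : `|s * h y| <= c.
  by rewrite normrM; apply: le_trans (hc y); rewrite ler_piMl.
have msh : measurable_fun setT (fun y => s * h y) by exact: measurable_funM.
have ish : Q.-integrable setT (fun y => (s * h y)%:E).
  apply: (@le_integrable _ _ _ Q _ measurableT _ (fun=> c%:E)) => //.
  - exact/measurable_EFinP.
  - by move=> y _ /=; rewrite lee_fin (le_trans (shc y))// ler_norm.
  - exact: finite_measure_integrable_cst.
(* [p + q * (s * h y)] is an affine minorant of the outer branch: the second-order bound with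
   [(s * h y) ^+ 2] replaced by [c ^+ 2]. *)
pose p := C * (1 - E * (1 + 2 * l ^+ 2 * c ^+ 2)).
pose q := C * E * l.
have q0 : 0 <= q by rewrite /q !mulr_ge0// ltW.
have ip : Q.-integrable setT (fun y => p%:E + q%:E * (s * h y)%:E)%E.
  apply: integrableD => //; first exact: finite_measure_integrable_cst.
  exact: integrableZl.
apply: (@le_trans _ _ (\int[Q]_y (p%:E + q%:E * (s * h y)%:E))%E).
  rewrite integralD//=; last 2 first.
  - exact: finite_measure_integrable_cst.
  - exact: integrableZl.
  rewrite integral_cst//= probability_setT mule1 integralZl//.
  apply: (@le_trans _ _ (p%:E + q%:E * eps%:E)%E).
    rewrite -EFinM -EFinD lee_fin -/E /p /q -subr_ge0.
    rewrite (_ : _ - _ = (C * E * l) * (eps - 4 * l * c ^+ 2) / 2); last by lra.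
    by rewrite !mulr_ge0 ?subr_ge0// ltW.
  by rewrite leeD2l// lee_wpmul2l ?lee_fin// ltW.
apply: le_integral => //.
  apply: (@le_integrable _ _ _ Q _ measurableT _
    (fun=> (Num.max (expR (A * L)) C)%:E)) => //.
  - move=> y _ /=; rewrite lee_fin ger0_norm ?lyap_ge0//.
    exact: le_trans (lyap_le _) (ler_norm _).
  - exact: finite_measure_integrable_cst.
move=> y _; rewrite -EFinM -EFinD lee_fin /W /lyap le_max; apply/orP; right.
apply: (@le_trans _ _
  (C * (1 - E * (1 + (- l * (s * h y)) + 2 * (- l * (s * h y)) ^+ 2)))).
  rewrite /p /q -subr_ge0.
  rewrite (_ : _ - _ = 2 * C * E * l ^+ 2 * (c ^+ 2 - (s * h y) ^+ 2)); last by lra.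
  rewrite mulr_ge0 ?subr_ge0//; first by rewrite !mulr_ge0// ltW.
  by rewrite -(real_normK (num_real (s * h y))) lerXn2r// nnegrE.
rewrite ler_wpM2l// lerD2l lerN2.
apply: (@le_trans _ _ (E * expR (- l * (s * h y)))); last first.
  rewrite ler_wpM2l// expR_le_quadratic//.
  have := shc y; rewrite ler_norml => /andP[h1 h2]; nra.
have key : `|m - a| + s * h y <= `|m + h y - a|.
  rewrite -sr -mulrDr addrAC (le_trans (ler_norm _))// normrM.
  by rewrite ler_piMl.
rewrite /E -expRD ler_expR -mulrDr !mulNr lerN2; apply: ler_wpM2l; [exact: ltW|lra].
Qed.

End lyapunov.

Lemma lyap_drift_outer_ae {R : realType} (a A L C l K : R) (Q : probability R R)
    (g : R -> R) (m s c eps : R) :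
  0 <= C -> measurable_fun setT g ->
  {ae Q, forall y, `|g y| <= c} -> 0 <= c -> `|s| <= 1 ->
  s * (m - a) = `|m - a| ->
  0 < l -> l * c <= 2^-1 -> 4 * l * c ^+ 2 <= eps ->
  (eps%:E < s%:E * \int[Q]_y (g y)%:E)%E ->
  ((C * (1 - expR (- l * (`|m - a| - K)))
    + C * expR (- l * (`|m - a| - K)) * l * eps / 2)%:E
     <= \int[Q]_y (lyap a A L C l K (m + g y))%:E)%E.
Proof.
move=> C0 mg gc c0 s1 sr l0 lc l4 seps.
(* Truncation changes [g] only on a null set, hence changes no integral, and makes the step bounded
   everywhere. *)
pose h y := if `|g y| <= c then g y else 0.
have mh : measurable_fun setT h.
  apply: measurable_fun_if => //.
  - by apply: measurable_fun_ler => //; exact: measurableT_comp.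
  - exact: measurable_funTS.
have hc y : `|h y| <= c by rewrite /h; case: ifP => //; rewrite normr0.
have gh : {ae Q, forall y, g y = h y}.
  by apply: filterS gc => y gyc; rewrite /h gyc.
have -> : (\int[Q]_y (lyap a A L C l K (m + g y))%:E =
           \int[Q]_y (lyap a A L C l K (m + h y))%:E)%E.
  apply: ge0_ae_eq_integral => //=.
  - apply/measurable_EFinP; apply: (measurableT_comp (measurable_lyap _ _ _ _ _ _)).
    exact: measurable_funD.
  - apply/measurable_EFinP; apply: (measurableT_comp (measurable_lyap _ _ _ _ _ _)).
    exact: measurable_funD.
  - by move=> y _; rewrite lee_fin lyap_ge0.
  - by move=> y _; rewrite lee_fin lyap_ge0.
  - by apply: filterS gh => y -> _.
apply: (lyap_drift_outer _ _ _ _ _ _ C0 Q h m mh s c) => //.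
have ih : Q.-integrable setT (fun y => (h y)%:E).
  apply: (@le_integrable _ _ _ Q _ measurableT _ (fun=> c%:E)) => //.
  - exact/measurable_EFinP.
  - by move=> y _ /=; rewrite lee_fin (le_trans (hc y))// ler_norm.
  - exact: finite_measure_integrable_cst.
rewrite (eq_integral (fun y => s%:E * (h y)%:E)%E) => [|y _]; last by rewrite EFinM.
rewrite integralZl//.
rewrite (_ : (\int[Q]_y (h y)%:E = \int[Q]_y (g y)%:E)%E)//.
apply: ae_eq_integral => //; [exact/measurable_EFinP|exact/measurable_EFinP|].
by apply: filterS gh => y -> _.
Qed.

Lemma exists_lyapunov {R : realType} (Q : probability R R) (g : R -> R -> R)
    (a c eps K : R) :
  (forall m, measurable_fun setT (g m)) -> 0 < eps -> 0 <= K ->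
  (forall L, exists e : R, [/\ 0 < e, e <= 2^-1,
    (forall m, a <= m <= a + L -> (e%:E <= Q [set y | (e < g m y)%R])%E) &
    (forall m, a - L <= m <= a -> (e%:E <= Q [set y | (g m y <= - e)%R])%E)]) ->
  (forall m, a + K <= m -> (eps%:E < \int[Q]_y (g m y)%:E)%E) ->
  (forall m, m <= a - K -> (\int[Q]_y (g m y)%:E < (- eps)%:E)%E) ->
  exists (W : R -> R) (B k l : R), [/\ measurable_fun setT W,
    (forall m, 0 <= W m <= B), 0 < k, 0 < l &
    forall m, {ae Q, forall y, `|g m y| <= c} ->
      ((W m + k * expR (- l * `|m - a|))%:E <= \int[Q]_y (W (m + g m y))%:E)%E].
Proof.
move=> mg eps0 K0 unif outp outn.
(* As [e <= 2^-1], the inner range [r <= L - e] and the outer range [K <= r] overlap at least on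
   [[K, K + 1/2]]. *)
pose L := K + 1; have [e [e0 e2 ep en]] := unif L.
pose A := 2 / (e * e); have A0 : 0 <= A by rewrite divr_ge0// mulr_ge0// ltW.
have Ae : 2 <= expR (A * e) * e.
  have h : 2 / e <= expR (A * e).
    apply: le_trans (expR_ge1Dx _); rewrite (_ : A * e = 2 / e); first lra.
    by rewrite /A invfM -!mulrA mulVf ?mulr1 ?gt_eqF.
  by rewrite -ler_pdivrMr.
(* The maximum makes the step bound positive, so that [l] is positive; the two entries of [l] are
   the two smallness conditions of the outer estimate. *)
pose c' := Num.max c 1; have c'1 : 1 <= c' by rewrite le_max lexx orbT.
pose l := Num.min (2 * c')^-1 (eps / (4 * c' ^+ 2)).
have c'0 : 0 < c' by exact: lt_le_trans c'1.
have l0 : 0 < l by rewrite lt_min invr_gt0 divr_gt0 ?mulr_gt0// exprn_gt0.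
have lc : l * c' <= 2^-1.
  rewrite -ler_pdivlMr//; apply: (@le_trans _ _ (2 * c')^-1).
    by rewrite ge_min lexx.
  by rewrite invfM.
have l4 : 4 * l * c' ^+ 2 <= eps.
  rewrite mulrAC mulrC -ler_pdivlMr ?mulr_gt0 ?exprn_gt0//.
  by rewrite ge_min lexx orbT.
have d0 : 0 < 1 - expR (- l / 2) by rewrite subr_gt0 expR_lt1; lra.
(* With this [C] the outer branch equals the cap [expR (A * L)] exactly at distance [K + 1/2]. *)
pose C := expR (A * L) / (1 - expR (- l / 2)).
have C0 : 0 < C by rewrite divr_gt0// expR_gt0.
(* The entry 1 serves the inner gain, which is at least 1; the other entry is the outer gain divided
   by [expR (- l * r)]. *)
pose k := Num.min 1 (C * expR (l * K) * l * eps / 2).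
have k0 : 0 < k.
  by rewrite lt_min ltr01 !(mulr_gt0, invr_gt0)// expR_gt0.
exists (lyap a A L C l K), (Num.max (expR (A * L)) C), k, l; split => //.
- exact: measurable_lyap.
- by move=> m; rewrite lyap_ge0 lyap_le// ltW.
move=> m gmc; set r := `|m - a|.
have r0 : 0 <= r by exact: normr_ge0.
have inner : r <= L - e -> ((2 * expR (A * r))%:E <=
    \int[Q]_y (lyap a A L C l K (m + g m y))%:E)%E.
  move=> rL; have [am|ma] := leP a m.
    have rE : r = m - a by rewrite /r ger0_norm// subr_ge0.
    apply: (lyap_drift_inner _ _ _ _ _ _ A0 Q _ _ (mg m) [set y | e < g m y] e) => //.
    + rewrite -[X in measurable X]setTI; apply: measurable_fun_ltr => //.
    + by apply: ep; lra.
    + by rewrite -/r; lra.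
    + move=> y /= egy; rewrite -/r ger0_norm; lra.
  have rE : r = a - m by rewrite /r ltr0_norm ?opprB// subr_lt0.
  apply: (lyap_drift_inner _ _ _ _ _ _ A0 Q _ _ (mg m) [set y | g m y <= - e] e) => //.
  + rewrite -[X in measurable X]setTI; apply: measurable_fun_ler => //.
  + by apply: en; lra.
  + by rewrite -/r; lra.
  + move=> y /= egy; rewrite -/r ler0_norm; lra.
have outer : K <= r -> ((C * (1 - expR (- l * (r - K)))
      + C * expR (- l * (r - K)) * l * eps / 2)%:E <=
    \int[Q]_y (lyap a A L C l K (m + g m y))%:E)%E.
  have gmc' : {ae Q, forall y, `|g m y| <= c'}.
    by apply: filterS gmc => y h; rewrite (le_trans h)// le_max lexx.
  move=> Kr; have [am|ma] := leP a m.
    have rE : r = m - a by rewrite /r ger0_norm// subr_ge0.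
    apply: (lyap_drift_outer_ae a A L C l K Q (g m) m 1 c') => //.
    + exact: ltW.
    + exact: ltW.
    + by rewrite normr1.
    + by rewrite mul1r -/r.
    + by rewrite mul1e; apply: outp; lra.
  have rE : r = a - m by rewrite /r ltr0_norm ?opprB// subr_lt0.
  apply: (lyap_drift_outer_ae a A L C l K Q (g m) m (-1) c') => //.
  + exact: ltW.
  + exact: ltW.
  + by rewrite normrN normr1.
  + by rewrite mulN1r -/r opprB.
  + by rewrite EFinN mulN1e lteNr -EFinN; apply: outn; lra.
have gain1 : k * expR (- l * r) <= expR (A * r).
  apply: (@le_trans _ _ 1); last by rewrite -expR0 ler_expR mulr_ge0.
  rewrite mulr_ile1 ?expR_ge0//; [exact: ltW|by rewrite ge_min lexx|].
  by rewrite expR_le1 mulNr oppr_le0 mulr_ge0// ltW.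
have gain2 : k * expR (- l * r) <= C * expR (- l * (r - K)) * l * eps / 2.
  rewrite mulrBr -mulNr opprK expRD.
  apply: (@le_trans _ _ (C * expR (l * K) * l * eps / 2 * expR (- l * r))); last lra.
  by rewrite ler_wpM2r ?expR_ge0// ge_min lexx orbT.
have W1r : Num.min (expR (A * r)) (expR (A * L)) <= expR (A * r).
  by rewrite ge_min lexx.
have in1 : r <= L - e -> ((Num.min (expR (A * r)) (expR (A * L))
      + k * expR (- l * r))%:E <=
    \int[Q]_y (lyap a A L C l K (m + g m y))%:E)%E.
  by move=> /inner; apply: le_trans; rewrite lee_fin; lra.
have out1 : K <= r -> ((C * (1 - expR (- l * (r - K))) + k * expR (- l * r))%:E <=
    \int[Q]_y (lyap a A L C l K (m + g m y))%:E)%E.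
  by move=> /outer; apply: le_trans; rewrite lee_fin; lra.
(* If the inner branch is the maximum, then [r <= L - e]: otherwise [r > K + 1/2], where the outer
   branch exceeds the cap. *)
rewrite [lyap a A L C l K m]/lyap -/r maxElt; case: ifPn => [h12|]; last first.
  rewrite -leNgt => h21; apply: in1; rewrite leNgt; apply/negP => rL.
  move: h21; apply/negP; rewrite -ltNge.
  apply: (@le_lt_trans _ _ (expR (A * L))); first by rewrite ge_min lexx orbT.
  rewrite -[ltLHS](@divfK _ (1 - expR (- l / 2))) ?gt_eqF// -/C.
  rewrite ltr_pM2l// ltrD2l ltrN2 ltr_expR !mulNr ltrN2 ltr_pM2l//.
  by rewrite /L in rL; lra.
(* If the outer branch is the maximum, then [K <= r]: below [K] it is nonpositive and cannot exceed
   the inner branch. *)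
apply: out1; rewrite leNgt; apply/negP => rK.
move: h12; apply/negP; rewrite -leNgt.
apply: (@le_trans _ _ 0); last by rewrite le_min !expR_ge0.
rewrite mulr_ge0_le0 ?(ltW C0)// subr_le0 -expR0 ler_expR mulNr -mulrN opprB.
by rewrite mulr_ge0 ?(ltW l0)// subr_ge0 ltW.
Qed.

(** * The uniform law and the extension of [f] beyond the unit interval *)

(* No measurability of [u] is assumed: this is a fact about lower integrals. *)
Lemma ge0_integral_conull d (T : measurableType d) (R : realType)
    (mu : {measure set T -> \bar R}) (D : set T) (u v : T -> \bar R) :
  measurable D -> mu (~` D) = 0%E -> measurable_fun setT v ->
  (forall x, 0 <= v x <= u x)%E -> (forall x, D x -> u x = v x) ->
  (\int[mu]_x u x = \int[mu]_x v x)%E.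
Proof.
move=> mD D0 mv uv uvD.
have v0 x : (0 <= v x)%E by have /andP[] := uv x.
have u0 x : (0 <= u x)%E by have /andP[? ?] := uv x; exact: le_trans (v0 x) _.
apply/eqP; rewrite eq_le; apply/andP; split; last first.
  rewrite !ge0_integralTE//; apply: ereal_sup_le => _ [h hv <-].
  exists h => // x.
  by have /andP[_] := uv x; exact: le_trans.
(* A simple function below [u] keeps its integral when restricted to [D], and there it lies below
   [v]. *)
rewrite [leLHS]ge0_integralTE//; apply: ge_ereal_sup => _ [h hu <-].
have <- : (\int[mu]_x (h x)%:E = sintegral mu h)%E.
  by rewrite integral_nnsfun// patch_setT.
rewrite (ge0_negligible_integral (measurableC mD))//; last first.
  by move=> x _; rewrite lee_fin.
  exact/measurable_EFinP.
rewrite setTD setCK.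
apply: (@le_trans _ _ (\int[mu]_(x in D) v x)%E); last exact: ge0_subset_integral.
apply: ge0_le_integral => //.
- by move=> x _; rewrite lee_fin.
- by apply/measurable_EFinP; exact: measurable_funTS.
- exact: measurable_funTS.
- by move=> x Dx; rewrite -uvD.
Qed.

Lemma U01_setI (R : realType) (A : set R) : U01 R A = U01 R (A `&` `[0, 1]).
Proof.
rewrite /U01 /uniform_prob integral_uniform_pdf [RHS]integral_uniform_pdf.
by rewrite -setIA setIid.
Qed.

Lemma measurable_fun_id_measurableTypeR (R : realType) :
  measurable_fun setT (idfun : measurableTypeR R -> R).
Proof. by move=> _ A mA; rewrite setTI; exact: mA. Qed.

Definition law d d' (T : measurableType d) (T' : measurableType d')
    (R : realType) (P : probability T R) (X : T -> T')
    (mX : measurable_fun setT X) : probability T' R :=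
  distribution P (mfun_Sub (mem_set mX)).

Arguments law {d d' T T' R} P {X} mX.

(* [U01] is a measure on [measurableTypeR R], which has the same measurable sets as
   [R] but another display; transporting it along the identity allows products
   with laws on [R]. *)
Definition U01R (R : realType) : probability R R :=
  law (uniform_prob (@ltr01 R) : probability (measurableTypeR R) R)
    (measurable_fun_id_measurableTypeR R).

Lemma U01RE (R : realType) (A : set R) : U01R R A = U01 R A.
Proof. by []. Qed.

(* [f] is only measurable on [R x [0, 1]]; outside it may be arbitrary. *)
Definition extend01 {R : realType} (f : R -> R -> R) (m y : R) : R :=
  if 0 <= y <= 1 then f m y else 0.

Section extend01.
Context {R : realType} (f : R -> R -> R).
Let g := extend01 f.

Lemma measurable_extend01 :
  measurable_fun (setT `*` `[(0:R), 1] : set (R * R)) (fun p => f p.1 p.2) ->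
  measurable_fun setT (fun p : R * R => g p.1 p.2).
Proof.
move=> mf; apply: measurable_fun_if => //.
apply: measurable_and.
  by apply: measurable_fun_ler => //; exact: measurable_snd.
by apply: measurable_fun_ler => //; exact: measurable_snd.
Qed.

Lemma Fdist_extend01 m x : Fdist f m x = fine (U01R R [set y | g m y <= x]).
Proof.
rewrite U01RE /Fdist U01_setI [in RHS]U01_setI; congr (fine (U01 R _)).
apply/seteqP; split => y /= [h]; rewrite in_itv/= => y01; split => //;
  by move: h; rewrite /g /extend01 y01.
Qed.

Hypothesis mf : measurable_fun (setT `*` `[(0:R), 1] : set (R * R)) (fun p => f p.1 p.2).

(** Since [f m] may fail to be measurable off [[0, 1]], positive and negative parts are compared
    separately as lower integrals: those of [g m] lie below those of [f m] and agree with them on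
    [[0, 1]]. *)
Lemma fbar_extend01 m : fbar f m = (\int[U01R R]_y (g m y)%:E)%E.
Proof.
have mg : measurable_fun setT (g m).
  by exact: (measurable_fun_pair2 m (measurable_extend01 mf)).
have D0 : U01 R (~` `[0, 1]) = 0%E by rewrite U01_setI setICl /U01 measure0.
have part (u v : R -> \bar R) : measurable_fun setT v ->
    (forall x, 0 <= v x <= u x)%E -> (forall x, `[0, 1]%classic x -> u x = v x) ->
    (\int[U01 R]_x u x = \int[U01R R]_x v x)%E.
  move=> mv uv uvD; transitivity (\int[U01 R]_x v x)%E.
    apply: (@ge0_integral_conull _ (measurableTypeR R) R
      (uniform_prob (@ltr01 R)) `[0, 1]%classic) => //.
  rewrite [RHS]ge0_integral_pushforward//=.
    exact: measurable_fun_id_measurableTypeR.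
  by move=> x _; have /andP[] := uv x.
rewrite /fbar integralE [RHS]integralE; congr (_ - _)%E; apply: part.
- exact/measurable_funepos/measurable_EFinP.
- move=> x; rewrite !funeposE le_max lexx orbT/= /g /extend01.
  by case: ifP => // _; rewrite maxxx le_max lexx orbT.
- by move=> x; rewrite /= in_itv/= !funeposE /g /extend01 => ->.
- exact/measurable_funeneg/measurable_EFinP.
- move=> x; rewrite !funenegE le_max lexx orbT/= /g /extend01.
  by case: ifP => // _; rewrite oppr0 maxxx le_max lexx orbT.
- by move=> x; rewrite /= in_itv/= !funenegE /g /extend01 => ->.
Qed.

End extend01.

(** * Markov property of the trajectory *)

Section markov_step.
Context d (Omega : measurableType d) {R : realType} (P : probability Omega R).
Context (g : R -> R -> R) (mu0 : R) (xi : nat -> Omega -> R).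
Hypothesis mg : measurable_fun setT (fun p : R * R => g p.1 p.2).
Hypothesis mxi : forall t, measurable_fun setT (xi t).
Context (Q : probability R R).
Hypothesis xiQ : forall t (A : set R), measurable A -> P (xi t @^-1` A) = Q A.
Hypothesis ind : mutually_independent P xi.
Let mu := traj g mu0 xi.

Lemma measurable_step : measurable_fun setT (fun p : R * R => p.1 + g p.1 p.2).
Proof. by apply: measurable_funD => //; exact: measurable_fst. Qed.

Lemma measurable_traj t : measurable_fun setT (mu t).
Proof.
rewrite /mu; elim: t => [|t IH]; first exact: measurable_cst.
exact: (measurableT_comp measurable_step (measurable_fun_pair IH (mxi t))).
Qed.

Let mpair t := measurable_fun_pair (measurable_traj t) (mxi t).

Let mcyl (s : seq nat) (B : nat -> set R) : (forall i, measurable (B i)) ->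
  measurable (\bigcap_(i in [set` s]) (xi i @^-1` B i)).
Proof.
move=> mB; rewrite bigcap_seq; apply: bigsetI_measurable => i _.
by rewrite -[X in measurable X]setTI; exact: mxi.
Qed.

Let cyl (s : seq nat) (B : nat -> set R) :=
  \bigcap_(i in [set` s]) (xi i @^-1` B i).

Let upd t (B0 : set R) (B : nat -> set R) i := if i == t then B0 else B i.

Let cyl_cons t s B B0 : t \notin s ->
  xi t @^-1` B0 `&` cyl s B = cyl (t :: s) (upd t B0 B).
Proof.
move=> ts; have updE i : i \in s -> upd t B0 B i = B i.
  by move=> si; rewrite /upd; case: eqP => // it; rewrite -it si in ts.
apply/seteqP; split => w /=.
  move=> [h1 h2] i /=; rewrite inE => /orP[/eqP ->|si].
    by rewrite /upd eqxx.
  by rewrite updE//; exact: h2.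
move=> h; split; first by have := h t (mem_head _ _); rewrite /upd eqxx.
by move=> i /= si; rewrite -updE//; apply: h; rewrite /= inE si orbT.
Qed.

Let measurable_upd t B0 B : measurable B0 -> (forall i, measurable (B i)) ->
  forall i, measurable (upd t B0 B i).
Proof. by move=> mB0 mB i; rewrite /upd; case: ifP. Qed.

Let P_cyl_cons t s B B0 : t \notin s -> uniq s -> (forall i, measurable (B i)) ->
  measurable B0 -> P (xi t @^-1` B0 `&` cyl s B) = (Q B0 * P (cyl s B))%E.
Proof.
move=> ts us mB mB0; rewrite cyl_cons// ind//=; [|by rewrite ts|exact: measurable_upd].
rewrite big_cons {1}/upd eqxx xiQ//; congr (_ * _)%E.
rewrite ind//; apply: eq_big_seq => i si.
by rewrite /upd; case: eqP => // it; rewrite -it si in ts.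
Qed.

Let rect_indep t s B A B0 :=
  P (mu t @^-1` A `&` xi t @^-1` B0 `&` cyl s B) =
  (P (mu t @^-1` A) * Q B0 * P (cyl s B))%E.

Let pair_indep t s B X :=
  P ((fun w => (mu t w, xi t w)) @^-1` X `&` cyl s B) =
  ((law P (measurable_traj t) \x Q) X * P (cyl s B))%E.

(** Uniqueness of product measures passes from rectangles to all measurable sets; the constant
    [P (cyl s B)] is absorbed as a scaling of the first marginal. *)
Let rect_pair t s B : (forall i, measurable (B i)) ->
  (forall A B0, measurable A -> measurable B0 -> rect_indep t s B A B0) ->
  forall X, measurable X -> pair_indep t s B X.
Proof.
move=> mB rect X mX; rewrite /pair_indep.
have fE : P (cyl s B) \is a fin_num by exact: fin_num_measure (mcyl _ _ mB).
have E0 : 0 <= fine (P (cyl s B)) by rewrite fine_ge0.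
pose k := NngNum E0.
have mp := mpair t.
pose m0 : {measure set (R * R) -> \bar R} :=
  pushforward (mrestr P (mcyl s B mB)) (fun w => (mu t w, xi t w)).
pose m' := m0 mp.
have -> : P ((fun w => (mu t w, xi t w)) @^-1` X `&` cyl s B) = m' X by [].
rewrite -(@product_measure_unique _ _ _ _ R
  (mscale k (law P (measurable_traj t))) Q m')//.
  rewrite /product_measure1 ge0_integral_mscale//=; last exact: measurable_fun_xsection.
  by rewrite fineK// muleC.
move=> A B0 mA mB0; rewrite /m' /= /pushforward /mrestr /=.
rewrite /mscale/= fineK//.
have rot (x y z : \bar R) : (x * y * z = y * z * x)%E by rewrite -muleA muleC.
apply: etrans (esym (rot _ _ _)); exact: rect.
Qed.

(* The pair (mu_t, xi_t) is independent of the events generated by the later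
   innovations: this is the form of the Markov property that is stable under
   the recursion. *)
Lemma traj_indep t (s : seq nat) (B : nat -> set R) :
  uniq s -> (forall i, i \in s -> (t < i)%N) -> (forall i, measurable (B i)) ->
  forall X : set (R * R), measurable X ->
  P ((fun w => (mu t w, xi t w)) @^-1` X `&`
     \bigcap_(i in [set` s]) (xi i @^-1` B i)) =
  ((law P (measurable_traj t) \x Q) X *
   P (\bigcap_(i in [set` s]) (xi i @^-1` B i)))%E.
Proof.
elim: t s B => [|t IH] s B us ts mB; apply: rect_pair => // A B0 mA mB0.
  rewrite /rect_indep.
  have [Amu|Amu] := pselect (A mu0).
    rewrite (_ : mu 0%N @^-1` A = setT); last by apply/seteqP; split.
    rewrite setTI probability_setT mul1e P_cyl_cons//.
    by apply/negP => /ts.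
  rewrite (_ : mu 0%N @^-1` A = set0); last by apply/seteqP; split.
  by rewrite !set0I measure0 !mul0e.
rewrite /rect_indep.
(* The event that [mu t.+1] lies in [A] concerns only the pair at time [t], and the condition on
   [xi t.+1] joins the later innovations, so the induction hypothesis applies to [t.+1 :: s]. *)
pose X := (fun p : R * R => p.1 + g p.1 p.2) @^-1` A.
have mX : measurable X by rewrite -[X in measurable X]setTI; exact: measurable_step.
have tns : t.+1 \notin s by apply/negP => /ts; rewrite ltnn.
have muE : P (mu t.+1 @^-1` A) = (law P (measurable_traj t) \x Q)%E X.
  have := IH [::] B isT (fun _ => ltac:(by [])) mB X mX.
  by rewrite set_nil bigcap_set0 setIT probability_setT mule1 => <-.
rewrite -setIA cyl_cons// muE.
have := IH (t.+1 :: s) _ _ _ (measurable_upd t.+1 B0 B mB0 mB) X mX; rewrite -/(cyl _ _).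
move=> ->.
- by rewrite -cyl_cons// P_cyl_cons// muleA.
- by rewrite /= tns.
- by move=> i; rewrite inE => /orP[/eqP ->//|/ts/ltnW].
Qed.

Lemma law_traj_pair t (X : set (R * R)) : measurable X ->
  P ((fun w => (mu t w, xi t w)) @^-1` X) = (law P (measurable_traj t) \x Q)%E X.
Proof.
move=> mX; have := traj_indep t [::] (fun=> setT) isT _ _ X mX.
by rewrite set_nil bigcap_set0 setIT probability_setT mule1 => ->.
Qed.

End markov_step.

(** * From drift to almost sure escape *)

Lemma summable_cvg0 (R : realType) (u : nat -> R) :
  (forall n, 0 <= u n) -> (\sum_(0 <= n <oo) (u n)%:E)%E \is a fin_num ->
  u @ \oo --> 0.
Proof.
move=> u0 fu; apply: cvg_series_cvg_0.
apply: nondecreasing_is_cvgn; first exact: nondecreasing_series.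
exists (fine (\sum_(0 <= n <oo) (u n)%:E)%E) => _ [n _ <-].
rewrite -lee_fin fineK// /series/= -sumEFin.
by apply: nneseries_lim_ge => k _ _; rewrite lee_fin.
Qed.

Lemma expRN_cvg0_cvg_pinfty (R : realType) (k l : R) (u : nat -> R) :
  0 < k -> 0 < l -> (fun t => k * expR (- l * u t)) @ \oo --> (0 : R) ->
  u @ \oo --> +oo.
Proof.
move=> k0 l0 /cvgrPdist_lt h; apply/cvgryPge => A.
have := h (k * expR (- l * A)); rewrite mulr_gt0 ?expR_gt0// => /(_ isT).
apply: filterS => n; rewrite sub0r normrN ger0_norm; last first.
  by rewrite mulr_ge0 ?expR_ge0// ltW.
by rewrite ltr_pM2l// ltr_expR !mulNr ltrN2 ltr_pM2l// => /ltW.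
Qed.

Lemma measurable_gain (R : realType) (k l a : R) :
  measurable_fun setT (fun m : R => k * expR (- l * `|m - a|)).
Proof.
apply: measurable_funM => //; apply: measurableT_comp => //.
apply: measurable_funM => //; apply: measurableT_comp => //.
exact: measurable_funB.
Qed.

Section drift.
Context d (Omega : measurableType d) {R : realType} (P : probability Omega R).
Context (g : R -> R -> R) (mu0 : R) (xi : nat -> Omega -> R).
Hypothesis mg : measurable_fun setT (fun p : R * R => g p.1 p.2).
Hypothesis mxi : forall t, measurable_fun setT (xi t).
Context (Q : probability R R).
Hypothesis xiQ : forall t (A : set R), measurable A -> P (xi t @^-1` A) = Q A.
Hypothesis ind : mutually_independent P xi.
Let mu := traj g mu0 xi.
Let mmu t : measurable_fun setT (mu t) := measurable_traj _ _ _ _ _ mg mxi t.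
Let mpair t : measurable_fun setT (fun w => (mu t w, xi t w)) :=
  measurable_fun_pair (mmu t) (mxi t).

(** The joint law of the state and the current innovation is a product, so Tonelli integrates the
    innovation out first. *)
Lemma integral_traj_pair t (phi : R * R -> \bar R) :
  measurable_fun setT phi -> (forall p, 0 <= phi p)%E ->
  (\int[P]_w phi (mu t w, xi t w) =
   \int[law P (mmu t)]_m \int[Q]_y phi (m, y))%E.
Proof.
move=> mphi phi0.
transitivity (\int[law P (mpair t)]_p phi p)%E.
  by rewrite [RHS]ge0_integral_pushforward.
rewrite -[RHS]fubini_tonelli1//; apply: eq_measure_integral => A mA _ /=.
rewrite -(law_traj_pair _ _ P g mu0 xi mg mxi Q xiQ ind t A mA).
by [].
Qed.

(** This turns the bound along trajectories into a bound at single states: the set of pairs with too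
    large a step is null for the product law, hence almost every section is null. *)
Lemma ae_law_bounded t (c : R) :
  {ae P, forall w, `|mu t.+1 w - mu t w| <= c} ->
  {ae law P (mmu t), forall m, {ae Q, forall y, `|g m y| <= c}}.
Proof.
move=> hc; pose X := [set p : R * R | c < `|g p.1 p.2|].
have mX : measurable X.
  rewrite -[X in measurable X]setTI; apply: measurable_fun_ltr => //.
  exact: measurableT_comp.
have X0 : P ((fun w => (mu t w, xi t w)) @^-1` X) = 0%E.
  apply/negligibleP; first by rewrite -[X in measurable X]setTI; exact: mpair.
  apply: negligibleS hc => w /= cg; rewrite /mu /= addrAC subrr add0r leNgt.
  by move/negP; apply.
have {}X0 : (\int[law P (mmu t)]_m `|(Q \o xsection X) m| = 0)%E.
  transitivity ((law P (mmu t) \x Q)%E X).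
    by apply: eq_integral => m _; rewrite gee0_abs.
  by rewrite -X0 -(law_traj_pair _ _ P g mu0 xi mg mxi Q xiQ ind t X mX).
have /(ae_eq_integral_abs (law P (mmu t)) measurableT
  (measurable_fun_xsection Q mX)) := X0.
apply: filterS => m /(_ Logic.I) /= QX0.
exists (xsection X m); split => //; first exact: measurable_xsection.
move=> y /= /negP; rewrite -ltNge => cg.
by apply/xsectionP.
Qed.

(** The drift inequality is integrated against the law of [mu t], almost all of whose states have
    steps bounded by [c]. *)
Lemma integral_drift t (W : R -> R) (k l a c : R) :
  measurable_fun setT W -> (forall m, 0 <= W m) -> 0 < k ->
  {ae P, forall w, `|mu t.+1 w - mu t w| <= c} ->
  (forall m, {ae Q, forall y, `|g m y| <= c} ->
    ((W m + k * expR (- l * `|m - a|))%:E <= \int[Q]_y (W (m + g m y))%:E)%E) ->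
  (\int[P]_w (W (mu t w))%:E + \int[P]_w (k * expR (- l * `|mu t w - a|))%:E <=
   \int[P]_w (W (mu t.+1 w))%:E)%E.
Proof.
move=> mW W0 k0 hc drift.
pose v m := k * expR (- l * `|m - a|).
have v0 m : 0 <= v m by rewrite mulr_ge0 ?expR_ge0// ltW.
have mv : measurable_fun setT v by exact: measurable_gain.
have mWmu s : measurable_fun setT (fun w => (W (mu s w))%:E).
  by apply/measurable_EFinP; exact: (measurableT_comp mW (mmu s)).
rewrite -ge0_integralD//=; last 3 first.
- by move=> w _; rewrite lee_fin.
- by move=> w _; rewrite lee_fin; exact: v0.
- by apply/measurable_EFinP; exact: (measurableT_comp mv (mmu t)).
have mWg : measurable_fun setT (fun p : R * R => (W (p.1 + g p.1 p.2))%:E).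
  by apply/measurable_EFinP; exact: (measurableT_comp mW (measurable_step _ mg)).
have -> : (\int[P]_w (W (mu t.+1 w))%:E =
           \int[law P (mmu t)]_m \int[Q]_y (W (m + g m y))%:E)%E.
  rewrite -(integral_traj_pair t (fun p => (W (p.1 + g p.1 p.2))%:E))//.
  by move=> p; rewrite lee_fin.
have -> : (\int[P]_w ((W (mu t w))%:E + (k * expR (- l * `|mu t w - a|))%:E) =
           \int[law P (mmu t)]_m (W m + v m)%:E)%E.
  rewrite [RHS]ge0_integral_pushforward//=.
    by apply/measurable_EFinP; exact: measurable_funD.
  by move=> m _; rewrite lee_fin addr_ge0.
apply: ae_ge0_le_integral => //.
- by move=> m _; rewrite lee_fin addr_ge0.
- by apply/measurable_EFinP; exact: measurable_funD.
- by move=> m _; apply: integral_ge0 => y _; rewrite lee_fin.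
- apply: (@measurable_fun_fubini_tonelli_F _ _ _ _ R Q
    (fun p : R * R => (W (p.1 + g p.1 p.2))%:E)) => //.
  by move=> p; rewrite lee_fin.
- by apply: filterS (ae_law_bounded t c hc) => m hm _; exact: drift.
Qed.

Lemma ae_cvg_pinfty (W : R -> R) (B k l a c : R) :
  measurable_fun setT W -> (forall m, 0 <= W m <= B) -> 0 < k -> 0 < l ->
  (forall t, {ae P, forall w, `|mu t.+1 w - mu t w| <= c}) ->
  (forall m, {ae Q, forall y, `|g m y| <= c} ->
    ((W m + k * expR (- l * `|m - a|))%:E <= \int[Q]_y (W (m + g m y))%:E)%E) ->
  {ae P, forall w, (fun t => `|mu t w - a|) @ \oo --> +oo}.
Proof.
move=> mW WB k0 l0 hc drift.
have W0 m : 0 <= W m by have /andP[] := WB m.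
pose v t w := k * expR (- l * `|mu t w - a|).
have v0 t w : 0 <= v t w by rewrite mulr_ge0 ?expR_ge0// ltW.
have mv t : measurable_fun setT (v t).
  exact: (measurableT_comp (measurable_gain _ k l a) (mmu t)).
(* Telescoped drift: as [W] takes values in [[0, B]], the expected gains sum to at most [B]. *)
have bound n : (\int[P]_w (W (mu 0%N w))%:E
    + \sum_(0 <= t < n) \int[P]_w (v t w)%:E <= \int[P]_w (W (mu n w))%:E)%E.
  elim: n => [|n IH]; first by rewrite big_geq// adde0.
  rewrite big_nat_recr//= addeA.
  by apply: le_trans (integral_drift n W k l a c mW W0 k0 (hc n) drift); rewrite leeD2r.
have sumB : (\sum_(0 <= t <oo) \int[P]_w (v t w)%:E <= B%:E)%E.
  apply: lime_le.
    apply: is_cvg_nneseries => n _ _.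
    by apply: integral_ge0 => w _; rewrite lee_fin.
  apply: nearW => n.
  apply: (@le_trans _ _ (\int[P]_w (W (mu n w))%:E)%E).
    apply: le_trans (bound n); rewrite leeDr// integral_ge0// => w _.
    by rewrite lee_fin.
  apply: (@le_trans _ _ (\int[P]_w B%:E)%E); last first.
    by rewrite integral_cst//= probability_setT mule1.
  apply: ge0_le_integral => //.
  - by move=> w _; rewrite lee_fin.
  - by apply/measurable_EFinP; exact: (measurableT_comp mW (mmu n)).
  - by move=> w _; rewrite lee_fin; have /andP[] := WB (mu n w).
(* An integrable sum is almost surely finite, so its terms tend to 0, which forces the distances to
   infinity. *)
have iv : P.-integrable setT (fun w => \sum_(0 <= t <oo) (v t w)%:E)%E.
  have sv0 w : (0 <= \sum_(0 <= t <oo) (v t w)%:E)%E.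
    by apply: nneseries_ge0 => n _ _; rewrite lee_fin.
  apply/integrableP; split.
    apply: ge0_emeasurable_sum => [n w _ _|n _]; first by rewrite lee_fin.
    exact/measurable_EFinP.
  under eq_integral do rewrite gee0_abs//.
  rewrite integral_nneseries//.
  - exact: le_lt_trans sumB (ltry _).
  - by move=> n; exact/measurable_EFinP.
  - by move=> n w _; rewrite lee_fin.
apply: filterS (integrable_ae measurableT iv) => w /(_ Logic.I) fv.
exact: expRN_cvg0_cvg_pinfty k0 l0 (summable_cvg0 _ _ (fun n => v0 n w) fv).
Qed.

End drift.

(** * Uniform outward steps and conclusion *)

Lemma uniform_escape (R : realType) (f : R -> R -> R) (a : R) :
  measurable_fun (setT `*` `[(0:R), 1] : set (R * R)) (fun p => f p.1 p.2) ->
  (forall m : R, {for (m, 0), continuous (fun p : R * R => Fdist f p.1 p.2)}) ->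
  (forall m, a <= m -> Fdist f m 0 < 1) ->
  (forall m, m <= a -> 0 < Fdist f m 0) ->
  forall L, exists e : R, [/\ 0 < e, e <= 2^-1,
    (forall m, a <= m <= a + L ->
       (e%:E <= U01R R [set y | (e < extend01 f m y)%R])%E) &
    (forall m, a - L <= m <= a ->
       (e%:E <= U01R R [set y | (extend01 f m y <= - e)%R])%E)].
Proof.
move=> mf Fc F1 F0 L.
have mle m x : measurable [set y | extend01 f m y <= x].
  rewrite -[X in measurable X]setTI; apply: measurable_fun_ler => //.
  exact: (measurable_fun_pair2 m (measurable_extend01 f mf)).
have fin m x : U01R R [set y | extend01 f m y <= x] = (Fdist f m x)%:E.
  by rewrite Fdist_extend01 fineK// fin_num_measure.
have up : \forall e \near 0^'+, forall m, a <= m <= a + L -> Fdist f m (1 * e) < 1 - e.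
  apply: (near_uniform_segment _ (fun p => Fdist f p.1 p.2)) => m /andP[am _].
  by split; [exact: Fc|exact: F1].
(* Negating [Fdist] turns its positivity at 0 into an upper bound, so the same compactness lemma
   applies, with [s = -1]. *)
have dn : \forall e \near 0^'+, forall m, a - L <= m <= a -> - Fdist f m (-1 * e) < 0 - e.
  apply: (near_uniform_segment _ (fun p => - Fdist f p.1 p.2)) => m /andP[_ ma].
  split; last by rewrite oppr_lt0; exact: F0.
  by apply: cvgN; exact: Fc.
have : \forall e \near (0 : R)^'+, [/\ 0 < e, e <= 2^-1,
    forall m, a <= m <= a + L -> Fdist f m (1 * e) < 1 - e &
    forall m, a - L <= m <= a -> - Fdist f m (-1 * e) < 0 - e].
  near=> e; split; near: e => //; [exact: nbhs_right_gt|exact: nbhs_right_le].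
move=> /filter_ex[e [e0 e2 {}up {}dn]]; exists e; split => // m mL.
- rewrite (_ : [set y | _] = ~` [set y | extend01 f m y <= e]); last first.
    by apply/seteqP; split => y /=; rewrite ltNge => /negP.
  rewrite probability_setC// fin -EFinB lee_fin.
  by have := up m mL; rewrite mul1r; lra.
- rewrite fin lee_fin.
  by have := dn m mL; rewrite mulN1r; lra.
Unshelve. all: by end_near. Qed.

Theorem theorem2 (R : realType) (d : measure_display) (Omega : measurableType d)
  (P : probability Omega R) (f : R -> R -> R) (mu0 : R)
  (xi : nat -> Omega -> R) :
  measurable_fun (setT `*` `[(0:R), 1] : set (R * R)) (fun p : R * R => f p.1 p.2) ->
  (forall t, measurable_fun setT (xi t)) ->
  (forall t (A : set R), measurable A -> P (xi t @^-1` A) = U01 R A) ->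
  mutually_independent P xi ->
  (forall m : R, {for (m, 0), continuous (fun p : R * R => Fdist f p.1 p.2)}) ->
  (exists mc : R, (forall m, mc <= m -> Fdist f m 0 < 1) /\
                  (forall m, m <= mc -> 0 < Fdist f m 0)) ->
  (exists c : R, forall t : nat,
      {ae P, forall w, `|traj f mu0 xi t.+1 w - traj f mu0 xi t w| <= c}) ->
  (exists eps : R, 0 < eps /\
      (\forall m \near +oo, (eps%:E < fbar f m)%E) /\
      (\forall m \near -oo, (fbar f m < (- eps)%:E)%E)) ->
  {ae P, forall w, (fun t => traj f mu0 xi t w) @ \oo --> +oo \/
                   (fun t => traj f mu0 xi t w) @ \oo --> -oo}.
Proof.
move=> mf mxi xiU ind Fc [a [F1 F0]] [c hc] [eps [eps0 [outp outn]]].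
pose g := extend01 f; have mg := measurable_extend01 f mf.
(* Almost surely no innovation ever leaves [[0, 1]], so the trajectories of [f] and of its extension
   coincide. *)
have xi01 : {ae P, forall w, forall t, 0 <= xi t w <= 1}.
  apply: ae_foralln => t; exists (xi t @^-1` (~` `[0, 1])); split.
  - by rewrite -[X in measurable X]setTI; apply: mxi => //; exact: measurableC.
  - rewrite [LHS]xiU; last exact: measurableC.
    by rewrite U01_setI setICl /U01 measure0.
  - by move=> w /= h; rewrite in_itv.
have fg : {ae P, forall w, forall t, traj f mu0 xi t w = traj g mu0 xi t w}.
  apply: filterS xi01 => w h; elim=> [//|t IH] /=.
  by rewrite -IH /g /extend01 h.
have hcg t : {ae P, forall w, `|traj g mu0 xi t.+1 w - traj g mu0 xi t w| <= c}.
  by apply: filterS2 fg (hc t) => w h; rewrite !h.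
have [Mp [_ hMp]] := outp; have [Mn [_ hMn]] := outn.
(* The drift bounds hold strictly beyond [Mp] and [Mn]; the added 1 makes them available at distance
   exactly [K] too. *)
pose K := Num.max 0 (Num.max (Mp - a + 1) (a - Mn + 1)).
have K0 : 0 <= K by rewrite le_max lexx.
have KMp : Mp - a + 1 <= K by rewrite !le_max lexx !orbT.
have KMn : a - Mn + 1 <= K by rewrite !le_max lexx !orbT.
have [W [B [k [l [mW WB k0 l0 drift]]]]] :=
  exists_lyapunov (U01R R) g a c eps K
    (fun m => measurable_fun_pair2 m mg) eps0 K0 (uniform_escape _ _ _ mf Fc F1 F0)
    (fun m (am : a + K <= m) => ltac:(
      rewrite -(fbar_extend01 f mf); apply: hMp => /=; lra))
    (fun m (am : m <= a - K) => ltac:(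
      rewrite -(fbar_extend01 f mf); apply: hMn => /=; lra)).
have := ae_cvg_pinfty _ _ P g mu0 xi mg mxi (U01R R) xiU ind W B k l a c
  mW WB k0 l0 hcg drift.
apply: filterS3 fg (ae_foralln hc) => w fgw hw cw.
apply: (cvg_pm_infty_bounded_steps _ _ a c) => //.
by under eq_fun do rewrite fgw.
Qed.
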